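(* Let $n\geq 2$ be an integer. The set $\hat{\mathcal{C}}_0(\mathbb{R}^n)$ is $n$-lineable but not $(n+2)$-lineable. That is, there exists a vector subspace $F$ of $\mathcal{C}_0(\mathbb{R}^n)$ with $\dim(F)=n$ and $F\smallsetminus\{0\}\subset \hat{\mathcal{C}}_0(\mathbb{R}^n)$, but there is no vector subspace $W$ of $\mathcal{C}_0(\mathbb{R}^n)$ with $\dim(W)=n+2$ and $W\smallsetminus\{0\}\subset \hat{\mathcal{C}}_0(\mathbb{R}^n)$.
   Context: $\mathbb{R}^n$ carries the Euclidean norm $\|\cdot\|$. $\mathcal{C}_0(\mathbb{R}^n)$ is the real vector space of all continuous functions $f:\mathbb{R}^n\to\mathbb{R}$ such that $\lim_{\|x\|\to\infty} f(x)=0$. $\hat{\mathcal{C}}_0(\mathbb{R}^n)$ is the subset of $\mathcal{C}_0(\mathbb{R}^n)$ consisting of all functions $f$ that attain their maximum at exactly one point, i.e. there is a unique $x_0\in\mathbb{R}^n$ with $f(x)\le f(x_0)$ for all $x\in\mathbb{R}^n$. For a vector space $E$ and a cardinal number $\beta\le\dim(E)$, a subset $A\subset E$ is $\beta$-lineable if there exists a vector subspace $F$ of $E$ with $\dim(F)=\beta$ and $F\smallsetminus\{0\}\subset A$. *)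

(* Defs.v *)
From HB Require Import structures.
From mathcomp Require Import all_boot all_order all_algebra.
From mathcomp Require Import all_classical all_reals all_analysis.

Set Implicit Arguments.
Unset Strict Implicit.
Unset Printing Implicit Defensive.

Import Order.TTheory GRing.Theory Num.Theory.
Import numFieldNormedType.Exports.

Local Open Scope classical_set_scope.
Local Open Scope ring_scope.

(** The library's norm on ['rV[R]_n] is the sup norm, so the Euclidean one is
    defined here; the topology on ['rV[R]_n] is the product topology. *)
Definition enorm (R : realType) (n : nat) (x : 'rV[R]_n) : R :=
  Num.sqrt (\sum_(i < n) x 0 i ^+ 2).

(** The filter of "||x|| -> oo". *)
Definition at_infinity (R : realType) (n : nat) : set_system 'rV[R]_n :=
  [set A | \forall r \near +oo, [set x | r < enorm x] `<=` A].

Global Instance at_infinity_filter (R : realType) (n : nat) :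
  Filter (@at_infinity R n).
Proof.
rewrite /at_infinity; split => /=.
- by near do by [].
- move=> A B /= hA hB; near=> r => x hx.
  by split; [apply: (near hA r)|apply: (near hB r)].
- by move=> A B AB /= hA; near=> r => x hx; apply: AB; apply: (near hA r).
Unshelve. all: by end_near.
Qed.

(** [R^o] is [R] seen as a vector space over itself. *)
Definition C0_pred (R : realType) (n : nat) : {pred 'rV[R]_n -> R^o} :=
  fun f => `[< continuous f /\ f x @[x --> @at_infinity R n] --> (0 : R^o) >].

Lemma C0_submod_closed (R : realType) (n : nat) :
  submod_closed (@C0_pred R n).
Proof.
split.
  by apply/asboolP; split; [exact: cst_continuous|exact: (@cvg_cst R^o)].
move=> a f g /asboolP[cf lf] /asboolP[cg lg]; apply/asboolP; split.
  move=> x; apply: (@cvgD R R^o) (cg x).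
  by apply: (@cvgZl_tmp R R^o); exact: cf.
rewrite [X in _ --> X](_ : _ = a *: (0 : R^o) + 0); last by rewrite scaler0 addr0.
apply: (@cvgD R R^o) lg.
exact: (@cvgZl_tmp R R^o).
Qed.

HB.instance Definition _ (R : realType) (n : nat) :=
  GRing.isSubmodClosed.Build R ('rV[R]_n -> R^o) (@C0_pred R n)
    (@C0_submod_closed R n).

Record C0 (R : realType) (n : nat) : Type := MkC0 {
  C0_fun :> 'rV[R]_n -> R^o;
  C0P : C0_fun \in @C0_pred R n
}.

HB.instance Definition _ (R : realType) (n : nat) := [isSub for @C0_fun R n].
HB.instance Definition _ (R : realType) (n : nat) := [Choice of C0 R n by <:].
HB.instance Definition _ (R : realType) (n : nat) :=
  [SubChoice_isSubLmodule of C0 R n by <:].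

Definition hatC0 (R : realType) (n : nat) : set (C0 R n) :=
  [set f : C0 R n | exists! x0 : 'rV[R]_n, forall x, f x <= f x0].

Definition has_dim (K : fieldType) (E : lmodType K) (F : {pred E}) (d : nat) :
    Prop :=
  exists b : 'I_d -> E,
    (forall c : 'I_d -> K, \sum_(i < d) c i *: b i = 0 -> forall i, c i = 0) /\
    (forall v : E, v \in F <-> exists c : 'I_d -> K, v = \sum_(i < d) c i *: b i).

Definition lineable (K : fieldType) (E : lmodType K) (A : set E) (d : nat) :
    Prop :=
  exists F : submodClosed E,
    has_dim F d /\ forall v : E, v \in F -> v != 0 -> A v.

(* Main.v *)
Require Import Defs.
From HB Require Import structures.
From mathcomp Require Import all_boot all_order all_algebra.
From mathcomp Require Import all_classical all_reals all_analysis.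
From mathcomp Require Import ring lra.

(** Existence: the functions [x |-> <c, x> / (1 + |x|^2)], for [c] in [R^n],
    form a space of dimension [n].  Completing the square,
    [|c| / 2 - <c, x> / (1 + |x|^2)] is a positive multiple of
    [| |c| x - c |^2], so for [c <> 0] the maximum is attained at [c / |c|]
    and nowhere else ([bump_max]).

    Non-existence: let [b_0, ..., b_(n+1)] span a space all of whose nonzero
    elements have a single maximum point.  For [c] in [R^(n+2)], [c <> 0],
    write [F_c = sum_i c_i b_i], let [X c] be the maximum point of [F_c] and
    [M c] the positive part of the maximum.  The map [X] is continuous at [c]
    when [M c > 0], because [F_c] is small outside a compact set
    ([argmax_continuous]); where [M c = 0] the maximum points of nearby
    functions may escape to infinity, but a bounded function of [X] multiplied
    by [M] remains continuous there ([weighted_continuous]).  With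
    [chart x = (1, atan x_1, ..., atan x_n)], which is bounded and injective,
    the map [c |-> M c * chart (X c) - M (- c) * chart (X (- c))] is thus odd
    and continuous from [R^(n+2) \ {0}] to [R^(n+1)].  By the Borsuk-Ulam
    theorem it vanishes at some [c].  There [M c = M (- c)], and either both
    are [0] or [X c = X (- c)]; in both cases [F_c] is constant, and so it has
    more than one maximum point ([chart_gap_nonzero]).

    Borsuk-Ulam itself is proved with simplicial chains modulo 2, a simplex
    being the list of its vertices and a chain a list of simplices.  Suppose
    [g_1, ..., g_d] are odd on [R^(d+1) \ {0}], and label each point by the
    signs [a_i] of the [g_i].  The cup product
    [delta a_1 u ... u delta a_d] is nonzero on a simplex only if
    every [a_i] takes both values on it.  Its value on a subdivided hemisphere
    of the cross-polytope is [1]: it is the coboundary of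
    [a_1 u delta a_2 u ... u delta a_d], so by Stokes it equals the value of
    that cochain on the boundary sphere; this sphere is the union of two
    antipodal hemispheres of one dimension less, and since
    [a_1 (- p) + a_1 p = 1] the two contributions add up to
    [delta a_2 u ... u delta a_d] on one of them; induction applies
    ([cup_hemisphere]).  So every subdivision contains a simplex on which all
    the signs vary, the barycentric subdivisions have mesh tending to [0], and
    by compactness some point is a common zero ([borsuk_ulam]). *)

Set Implicit Arguments.
Unset Strict Implicit.
Unset Printing Implicit Defensive.

Import Order.TTheory GRing.Theory Num.Theory.
Import numFieldNormedType.Exports.

Local Open Scope classical_set_scope.
Local Open Scope ring_scope.

(** * Chains modulo 2 *)

Local Notation "\xor_ ( i <- r ) F" := (\big[addb/false]_(i <- r) F)
  (at level 41, F at level 41, i, r at level 50).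

(** Equality of chains modulo 2, tested against all cochains: the order of the
    simplices and pairs of equal simplices do not count. *)
Definition eq2 (T : Type) (C D : seq T) : Prop :=
  forall phi : T -> bool, \xor_(s <- C) phi s = \xor_(s <- D) phi s.

Lemma eq2_flatten_map (T T' : Type) (f : T -> seq T') (C D : seq T) :
  eq2 C D -> eq2 (flatten (map f C)) (flatten (map f D)).
Proof. by move=> CD phi; rewrite !big_flatten !big_map; exact: CD. Qed.

Lemma eq2_iter (T : Type) (f : seq T -> seq T) (C D : seq T) N :
  (forall C D, eq2 C D -> eq2 (f C) (f D)) -> eq2 C D ->
  eq2 (iter N f C) (iter N f D).
Proof. by move=> fP CD; elim: N => [|N IH] //=; exact: fP. Qed.

(** The empty list is the only face of a point: the chain complex is the
    augmented one. *)
Fixpoint faces (T : Type) (s : seq T) : seq (seq T) :=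
  if s is v :: s' then s' :: map (cons v) (faces s') else [::].

Definition boundary (T : Type) (C : seq (seq T)) : seq (seq T) :=
  flatten (map (@faces T) C).

Section Boundary.
Variable T : Type.
Implicit Types (s t u : seq T) (C D : seq (seq T)) (phi : seq T -> bool).

Lemma xor_faces_cons phi v s :
  \xor_(t <- faces (v :: s)) phi t =
  phi s (+) \xor_(t <- faces s) phi (v :: t).
Proof. by rewrite /= big_cons big_map. Qed.

(** With signs dropped, each pair of removed vertices is counted twice. *)
Lemma boundary_boundary s phi :
  \xor_(t <- faces s) \xor_(u <- faces t) phi u = false.
Proof.
elim: s phi => [|v s IH] phi; first by rewrite big_nil.
rewrite xor_faces_cons (eq_bigr _ (fun t _ => xor_faces_cons phi v t)).
by rewrite big_split /= IH addbF addbb.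
Qed.

Lemma xor_boundary phi C :
  \xor_(t <- boundary C) phi t = \xor_(s <- C) \xor_(t <- faces s) phi t.
Proof. by rewrite big_flatten big_map. Qed.

End Boundary.

Lemma size_faces (T : eqType) (s t : seq T) : t \in faces s -> size s = (size t).+1.
Proof.
elim: s t => //= v s IH t; rewrite inE => /orP[/eqP->//|/mapP[u us ->]] /=.
by rewrite (IH _ us).
Qed.

Lemma mem_faces (T : eqType) (s t : seq T) :
  t \in faces s -> {subset t <= s}.
Proof.
elim: s t => //= v s IH t; rewrite inE => /orP[/eqP->|/mapP[u us ->]] x.
  by rewrite inE orbC => ->.
by rewrite !inE => /orP[->//|/(IH _ us)->]; rewrite orbT.
Qed.

Lemma map_faces (T T' : Type) (f : T -> T') (s : seq T) :
  faces (map f s) = map (map f) (faces s).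
Proof. by elim: s => //= v s ->; rewrite -!map_comp. Qed.

Lemma boundary_map (T T' : Type) (f : T -> T') (C : seq (seq T)) :
  boundary (map (map f) C) = map (map f) (boundary C).
Proof.
by elim: C => //= s C; rewrite /boundary /= map_cat map_faces => ->.
Qed.

(** * Cup products of coboundaries of vertex labellings *)

(** The value on [p_0, ..., p_k] of the cup product of the coboundaries of
    [k] labellings, namely the product of the [a_i p_(i-1) + a_i p_i]; the lists
    are only meant to be used with matching lengths. *)
Fixpoint cup (T : Type) (ls : seq (T -> bool)) (s : seq T) : bool :=
  if ls is a :: ls' then
    if s is p :: s' then
      if s' is q :: _ then (a p (+) a q) && cup ls' s' else true
    else true
  else true.

(** The cochain [a_1 u delta a_2 u ... u delta a_k], in one degree less than
    [cup].  For [k = 0] it is the augmentation, whose coboundary is the constant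
    cochain 1 on points. *)
Definition cup_primitive (T : Type) (ls : seq (T -> bool)) (s : seq T) : bool :=
  if ls is a :: ls' then if s is q :: _ then a q && cup ls' s else false else true.

Section Cup.
Variable T : eqType.
Implicit Types (a : T -> bool) (ls : seq (T -> bool)) (s : seq T).

(** The Leibniz rule [delta (a u z) = delta a u z + a u delta z], where
    [delta z = 0]. *)
Lemma cup_exact_of_closed a ls s :
  (forall t, size t = (size ls).+2 -> \xor_(u <- faces t) cup ls u = false) ->
  size s = (size ls).+2 ->
  cup (a :: ls) s = \xor_(t <- faces s) cup_primitive (a :: ls) t.
Proof.
case: s => [|p [|q s]] // closed sz.
have := closed _ sz; rewrite !(xor_faces_cons _ p).
case: ls {closed} sz => [|a' ls] sz.
  case: s sz => // _ _.
  by rewrite /= big_cons big_nil /= !andbT addbF addbC.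
set z := cup _ (q :: s); set Z := \big[_/_]_(_ <- _) _ => /negbT.
rewrite negb_add => /eqP zZ.
rewrite [LHS]/= -/z [X in _ = X (+) _]/= -/z.
transitivity ((a q && z) (+) (a p && Z)).
  by rewrite -zZ -andb_addl addbC.
by congr (_ (+) _); rewrite /Z big_distrr.
Qed.

(** A cup product of coboundaries is itself a coboundary, and
    [delta (delta w) = 0]. *)
Lemma cup_closed ls s :
  size s = (size ls).+2 -> \xor_(t <- faces s) cup ls t = false.
Proof.
elim: ls s => [|a ls IH] s sz.
  by case: s sz => [|p [|q []]] //= _; rewrite !big_cons big_nil.
rewrite -[RHS](boundary_boundary s (cup_primitive (a :: ls))).
rewrite !big_seq; apply: eq_bigr => t ts.
apply: cup_exact_of_closed => //.
by move: sz; rewrite (size_faces ts) => -[].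
Qed.

Lemma cup_exact ls s :
  size s = (size ls).+1 ->
  cup ls s = \xor_(t <- faces s) cup_primitive ls t.
Proof.
case: ls => [|a ls] sz; last exact: cup_exact_of_closed (@cup_closed ls) _.
by case: s sz => [|p []] //= _; rewrite big_seq1.
Qed.

(** A nonzero product has all its factors nonzero. *)
Lemma cup_witness ls s a :
  size s = (size ls).+1 -> cup ls s -> List.In a ls ->
  exists p q, [/\ p \in s, q \in s & a p != a q].
Proof.
elim: ls s => // a' ls IH [|p [|q s]] // [sz] /= /andP[pq cu] [<-|/IH].
  by exists p, q; rewrite !inE !eqxx orbT -negb_add pq.
case/(_ (q :: s)) => // [|p' [q' [p's q's neq]]]; first by rewrite /= sz.
by exists p', q'; rewrite in_cons p's orbT in_cons q's orbT.
Qed.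

End Cup.

(** * Barycentric subdivision *)

Section Subdivision.
Variables (R : realType) (V : normedModType R).
Implicit Types (s t u : seq V) (C D : seq (seq V)).

Lemma sumr_const_seq (W : nmodType) (x : W) s :
  \sum_(v <- s) x = x *+ size s.
Proof. by rewrite big_const_seq count_predT iter_addr_0. Qed.

Definition barycenter s : V := (size s)%:R^-1 *: \sum_(v <- s) v.

(** The cone from the barycenter over the subdivided boundary.  The first
    argument is the number of vertices, on which the recursion is made. *)
Fixpoint subdiv n s : seq (seq V) :=
  if n is n'.+1 then
    map (cons (barycenter s)) (flatten (map (subdiv n') (faces s)))
  else [:: [::]].

Definition subdiv_chain n C := flatten (map (subdiv n) C).

Lemma size_subdiv n s t : t \in subdiv n s -> size t = n.
Proof.
elim: n s t => [|n IH] s t /=; first by rewrite inE => /eqP->.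
by case/mapP => u /flatten_mapP[f _ /IH <-] ->.
Qed.

(** Subdivision is a chain map: the boundary of the cone over the subdivided
    boundary is that boundary plus the cone over its own boundary, and the
    latter vanishes, by induction and [boundary_boundary]. *)
Lemma subdiv_boundary n s (phi : seq V -> bool) : size s = n.+1 ->
  \xor_(t <- subdiv n.+1 s) \xor_(u <- faces t) phi u =
  \xor_(t <- faces s) \xor_(u <- subdiv n t) phi u.
Proof.
elim: n s phi => [|n IH] s phi sz.
  by case: s sz => [|v []] //= _; rewrite !big_seq1.
rewrite [in LHS]/= big_map (eq_bigr _ (fun t _ => xor_faces_cons phi _ t)).
rewrite big_split /= !big_flatten !big_map.
(* the cone over the boundary of the subdivided boundary vanishes *)
rewrite [X in _ (+) X](_ : _ = false) ?addbF//.
rewrite -[RHS](boundary_boundary s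
  (fun w => \xor_(u <- subdiv n w) phi (barycenter s :: u))).
rewrite !big_seq; apply: eq_bigr => t ts.
rewrite (IH t (fun u => phi (barycenter s :: u)))//.
by move: sz; rewrite (size_faces ts) => -[].
Qed.

Lemma xor_subdiv_chain n C (phi : seq V -> bool) :
  \xor_(t <- subdiv_chain n C) phi t =
  \xor_(s <- C) \xor_(t <- subdiv n s) phi t.
Proof. by rewrite big_flatten big_map. Qed.

Lemma eq2_subdiv_chain n C D :
  eq2 C D -> eq2 (subdiv_chain n C) (subdiv_chain n D).
Proof. exact: eq2_flatten_map. Qed.

Lemma iter_subdiv_ind n (P : seq V -> Prop) C N :
  (forall s, s \in C -> P s) ->
  (forall s t, P s -> t \in subdiv n s -> P t) ->
  forall s, s \in iter N (subdiv_chain n) C -> P s.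
Proof.
move=> PC Psd; elim: N => [|N IH] //= t /flatten_mapP[s /IH].
exact: Psd.
Qed.

Lemma iter_subdiv_boundary n C N :
  (forall s, s \in C -> size s = n.+1) ->
  eq2 (boundary (iter N (subdiv_chain n.+1) C))
      (iter N (subdiv_chain n) (boundary C)).
Proof.
move=> szC; elim: N => [|N IH] //= phi.
rewrite -(eq2_subdiv_chain n IH) xor_boundary !xor_subdiv_chain xor_boundary.
rewrite !big_seq; apply: eq_bigr => s sC; apply: subdiv_boundary.
apply: (@iter_subdiv_ind n.+1 (fun s => size s = n.+1)) sC => //.
by move=> ? t _; exact: size_subdiv.
Qed.

(** The consequence of convexity that subdivision needs. *)
Definition barycenter_closed (P : V -> Prop) :=
  forall s, s != [::] -> (forall v, v \in s -> P v) -> P (barycenter s).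

Lemma subdiv_convex (P : V -> Prop) n s t : barycenter_closed P ->
  (forall v, v \in s -> P v) -> t \in subdiv n s -> forall v, v \in t -> P v.
Proof.
move=> Pb; elim: n s t => [|n IH] s t Ps /=; first by rewrite inE => /eqP->.
case/mapP => u /flatten_mapP[f fs uf] -> v; rewrite inE => /orP[/eqP->|].
  by apply: Pb => //; case: s fs {Ps}.
by apply: IH uf v => v /(mem_faces fs); exact: Ps.
Qed.

Lemma barycenter_closed_ball (x : V) (r : R) :
  barycenter_closed (fun v => `|v - x| <= r).
Proof.
move=> s s0 sr.
have m0 : 0 < (size s)%:R :> R by rewrite ltr0n; case: s s0 {sr}.
have -> : barycenter s - x = (size s)%:R^-1 *: \sum_(v <- s) (v - x).
  rewrite big_split /= sumr_const_seq scalerDr; congr (_ + _).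
  by rewrite -(scaler_nat _ (- x)) scalerA mulVf ?scale1r ?gt_eqF.
rewrite normrZ gtr0_norm ?invr_gt0// ler_pdivrMl//.
apply: le_trans (ler_norm_sum _ _ _) _.
rewrite mulr_natl -sumr_const_seq !big_seq.
exact: ler_sum.
Qed.

(** Of the [size s] terms of the average of the [u - v], one is [0]. *)
Lemma barycenter_dist s (r : R) (u : V) : u \in s ->
  (forall v w, v \in s -> w \in s -> `|v - w| <= r) ->
  `|u - barycenter s| <= (size s).-1%:R / (size s)%:R * r.
Proof.
move=> us sr.
have m0 : 0 < (size s)%:R :> R by rewrite ltr0n; case: s us {sr}.
have -> : u - barycenter s = (size s)%:R^-1 *: \sum_(v <- s) (u - v).
  rewrite big_split /= sumr_const_seq scalerDr sumrN scalerN; congr (_ + _).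
  by rewrite -(scaler_nat _ u) scalerA mulVf ?scale1r ?gt_eqF.
rewrite normrZ gtr0_norm ?invr_gt0// mulrC -mulrA [X in _ <= _ * X]mulrC.
rewrite mulrA ler_pM2r ?invr_gt0//.
(* the vanishing term is what gains the factor [(size s).-1 / size s] *)
rewrite (big_rem u)//= subrr add0r.
apply: le_trans (ler_norm_sum _ _ _) _.
rewrite mulr_natl -(size_rem us) -sumr_const_seq !big_seq.
by apply: ler_sum => v /mem_rem vs; exact: sr.
Qed.

(** Two new vertices either come from one subdivided facet, where induction
    applies, or one of them is the barycenter and the other lies in the convex
    hull of [s], hence in the ball that [barycenter_dist] provides. *)
Lemma subdiv_mesh d n s t (r : R) : size s = n -> (n <= d.+1)%N -> 0 <= r ->
  (forall v w, v \in s -> w \in s -> `|v - w| <= r) ->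
  t \in subdiv n s ->
  forall v w, v \in t -> w \in t -> `|v - w| <= d%:R / d.+1%:R * r.
Proof.
elim: n s t => [|n IH] s t sz nd r0 sr /=.
  by rewrite inE => /eqP->.
case/mapP => t' /flatten_mapP[f fs t'f] ->.
have near_b v : v \in t' -> `|v - barycenter s| <= d%:R / d.+1%:R * r.
  apply: (@subdiv_convex _ n f t' (barycenter_closed_ball (x := _) (r := _))) => //.
  move=> u /(mem_faces fs) us; apply: le_trans (barycenter_dist us sr) _.
  rewrite sz /= ler_wpM2r// ler_pdivrMr ?ltr0n// mulrAC ler_pdivlMr ?ltr0n//.
  by rewrite -!natrM ler_nat !mulnS [(d * n)%N]mulnC leq_add2r -ltnS.
move=> v w; rewrite !inE => /orP[/eqP->|vt'] /orP[/eqP->|wt'].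
- by rewrite subrr normr0 mulr_ge0// divr_ge0.
- by rewrite distrC; exact: near_b.
- exact: near_b.
- apply: (IH f t') => //; first by move: sz; rewrite (size_faces fs) => -[].
  + exact: ltnW.
  + by move=> a b /(mem_faces fs) sa /(mem_faces fs) sb; exact: sr.
Qed.

Lemma subdiv_opp n s :
  subdiv n (map -%R s) = map (map -%R) (subdiv n s).
Proof.
elim: n s => [|n IH] s //=.
rewrite map_faces -map_comp (eq_map (g := map (map -%R) \o subdiv n)); last exact: IH.
rewrite map_comp -map_flatten -!map_comp; apply: eq_map => t /=.
by rewrite /barycenter size_map big_map sumrN scalerN.
Qed.

End Subdivision.

(** * The hemispheres of the cross-polytope *)

Section CrossPolytope.
Variables (R : realType) (V : normedModType R) (e : nat -> V).
Implicit Types (s t : seq V) (C : seq (seq V)).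

Local Notation opp_chain := (map (map (@GRing.opp V))).

(** The chain of all facets [+-e_(k-1), ..., +-e_0] of the cross-polytope of
    dimension [k].  It triangulates the sphere of dimension [k - 1], and is the
    empty simplex for [k = 0]. *)
Fixpoint cross k : seq (seq V) :=
  if k is k'.+1 then
    map (cons (e k')) (cross k') ++ opp_chain (map (cons (e k')) (cross k'))
  else [:: [::]].

(** The half of [cross k.+1] with vertex [+e_k], a disc of dimension [k]. *)
Definition hemisphere k := map (cons (e k)) (cross k).

Lemma crossS k : cross k.+1 = hemisphere k ++ opp_chain (hemisphere k).
Proof. by []. Qed.

Lemma size_cross k t : t \in cross k -> size t = k.
Proof.
elim: k t => [|k IH] t; first by rewrite inE => /eqP->.
rewrite crossS mem_cat => /orP[|/mapP[u + ->]].
  by case/mapP => u /IH <- ->.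
by rewrite size_map; case/mapP => v /IH <- ->.
Qed.

Lemma size_hemisphere k t : t \in hemisphere k -> size t = k.+1.
Proof. by case/mapP => u /size_cross <- ->. Qed.

Lemma cross_opp k : eq2 (opp_chain (cross k)) (cross k).
Proof.
case: k => [|k] //= phi; rewrite map_cat !big_cat /= addbC.
congr (_ (+) _); rewrite -map_comp map_id_in // => t _ /=.
by rewrite -map_comp map_id_in // => v _ /=; rewrite opprK.
Qed.

(** The hemisphere is a cone over [cross k], so its boundary is [cross k] as
    soon as [cross k] is a cycle; and [cross k.+1] is a cycle because the
    boundaries of its two hemispheres are [cross k] and the antipode of
    [cross k]. *)
Lemma boundary_hemisphere k : eq2 (boundary (hemisphere k)) (cross k).
Proof.
suff cone j : eq2 (boundary (cross j)) [::] ->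
    eq2 (boundary (hemisphere j)) (cross j).
  suff H : eq2 (boundary (cross k)) [::] by exact: cone.
  elim: k => [|k IH] phi; first by [].
  rewrite crossS /boundary map_cat flatten_cat big_cat /=.
  rewrite -!/(boundary _) (cone k IH) big_nil.
  rewrite boundary_map big_map (cone k IH (phi \o map -%R)) /=.
  by rewrite -(big_map (map -%R) predT) cross_opp addbb.
move=> closed phi.
rewrite xor_boundary big_map (eq_bigr _ (fun t _ => xor_faces_cons phi _ t)).
by rewrite big_split /= -xor_boundary closed big_nil addbF.
Qed.

Lemma iter_subdiv_cat n C C' N :
  iter N (@subdiv_chain R V n) (C ++ C') =
  iter N (@subdiv_chain R V n) C ++ iter N (@subdiv_chain R V n) C'.
Proof.
by elim: N => //= N ->; rewrite /subdiv_chain map_cat flatten_cat.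
Qed.

Lemma iter_subdiv_opp n C N :
  iter N (@subdiv_chain R V n) (opp_chain C) =
  opp_chain (iter N (@subdiv_chain R V n) C).
Proof.
elim: N => //= N ->; rewrite /subdiv_chain map_flatten -!map_comp.
by congr flatten; apply: eq_map => t /=; rewrite subdiv_opp.
Qed.

Definition antipodal (a : V -> bool) (v : V) := a (- v) = ~~ a v.

Lemma cup_opp ls t :
  (forall a v, List.In a ls -> v \in t -> antipodal a v) ->
  cup ls (map -%R t) = cup ls t.
Proof.
elim: ls t => [|a ls IH] [|p [|q t]] //= anti.
rewrite -[- q :: _]/(map -%R (q :: t)) -(IH (q :: t)); last first.
  by move=> b v bls vt; apply: anti; [right|rewrite inE vt orbT].
rewrite !anti ?inE ?eqxx ?orbT//; try by left.
by rewrite addNb addbN negbK.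
Qed.

(** The combinatorial core of Borsuk-Ulam: by Stokes the left-hand side is the
    value of [cup_primitive] on the boundary sphere, where antipodal simplices
    pair up. *)
Lemma cup_hemisphere N ls :
  (forall a k t v, List.In a ls -> (k <= size ls)%N ->
     t \in iter N (@subdiv_chain R V k) (cross k) -> v \in t -> antipodal a v) ->
  \xor_(t <- iter N (@subdiv_chain R V (size ls).+1) (hemisphere (size ls)))
    cup ls t = true.
Proof.
set sd := @subdiv_chain R V.
have szsd k t : t \in iter N (sd k.+1) (hemisphere k) -> size t = k.+1.
  apply: (@iter_subdiv_ind _ _ k.+1 (fun t => size t = k.+1)) => //.
    exact: size_hemisphere.
  by move=> ? ? _; exact: size_subdiv.
have stokes ls' : \xor_(t <- iter N (sd (size ls').+1) (hemisphere (size ls')))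
      cup ls' t =
    \xor_(t <- iter N (sd (size ls')) (cross (size ls'))) cup_primitive ls' t.
  transitivity (\xor_(t <- boundary (iter N (sd (size ls').+1)
      (hemisphere (size ls')))) cup_primitive ls' t).
    rewrite xor_boundary !big_seq; apply: eq_bigr => t /szsd tsz.
    exact: cup_exact.
  rewrite iter_subdiv_boundary; last exact: size_hemisphere.
  apply: eq2_iter; last exact: boundary_hemisphere.
  exact: eq2_subdiv_chain.
elim: ls => [|a ls IH] anti; rewrite stokes.
  by rewrite [iter _ _ _](_ : _ = [:: [::]]) ?big_seq1//; elim: (N) => //= n ->.
rewrite -[RHS]IH; last by move=> b k t v bls kls; apply: anti; [right|exact: ltnW].
rewrite [size _]/= crossS iter_subdiv_cat iter_subdiv_opp big_cat big_map /=.
rewrite -big_split !big_seq; apply: eq_bigr => t tsd /=.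
have anti_t b v : List.In b (a :: ls) -> v \in t -> antipodal b v.
  move=> bls; apply: (anti b (size ls).+1) => //.
  by rewrite crossS iter_subdiv_cat mem_cat tsd.
case: t {tsd} (szsd _ _ tsd) anti_t => //= q t _ anti_t.
rewrite -[- q :: _]/(map -%R (q :: t)) cup_opp; last first.
  by move=> b v bls; apply: anti_t; right.
rewrite anti_t ?mem_head//; last by left.
by case: (a q); rewrite //= ?addbF.
Qed.

End CrossPolytope.

(** * The Borsuk-Ulam theorem *)

Lemma rV_coord_le (R : realType) n (v : 'rV[R]_n) i : `|v 0 i| <= `|v|.
Proof.
rewrite [leRHS]/Num.norm /= mx_normrE; apply/bigmax_geP; right => /=.
by exists (ord0, i).
Qed.

Lemma rV_norm_le (R : realType) n (v : 'rV[R]_n) (r : R) :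
  0 <= r -> (forall i, `|v 0 i| <= r) -> `|v| <= r.
Proof.
move=> r0 vr; rewrite [leLHS]/Num.norm /= mx_normrE; apply/bigmax_leP.
by split=> // -[i j] _ /=; rewrite ord1.
Qed.

Lemma xor_true (T : eqType) (C : seq T) (phi : T -> bool) :
  \xor_(t <- C) phi t = true -> exists2 t, t \in C & phi t.
Proof.
elim: C => [|t C IH]; first by rewrite big_nil.
rewrite big_cons; have [pt _|pt] := boolP (phi t).
  by exists t; rewrite ?mem_head.
rewrite addFb => xorC; have [u uC pu] := IH xorC.
by exists u; rewrite // in_cons uC orbT.
Qed.

(** A face of the cross-polytope has no two opposite vertices: one choice of
    signs [s] serves for all its vertices. *)
Lemma cross_vertices (R : realType) (V : normedModType R) (e : nat -> V) k t :
  t \in cross e k ->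
  exists s : nat -> bool, forall v, v \in t ->
    exists2 j, (j < k)%N & v = (-1) ^+ s j *: e j.
Proof.
elim: k t => [|k IH] t; first by rewrite inE => /eqP->; exists xpredT.
have hem u : u \in hemisphere e k -> exists s : nat -> bool,
    forall v, v \in u -> exists2 j, (j < k.+1)%N & v = (-1) ^+ s j *: e j.
  case/mapP => w /IH[s sP] ->; exists (fun j => (j != k) && s j) => v.
  rewrite inE => /orP[/eqP->|/sP[j jk ->]].
    by exists k; rewrite // eqxx expr0 scale1r.
  by exists j; rewrite ?ltn_eqF ?ltnS ?(ltnW jk).
rewrite crossS mem_cat => /orP[/hem//|/mapP[u /hem[s sP] ->]].
exists (fun j => ~~ s j) => v /mapP[w /sP[j jk ->] ->].
by exists j; rewrite // signrN scaleNr.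
Qed.

Section BorsukUlam.
Variables (R : realType) (d : nat).
Local Notation V := 'rV[R]_d.+1.
Implicit Types (s : 'I_d.+1 -> bool) (v w : V).

Definition axis k : V := delta_mx 0 (inord k).

(** The facet of the l1 unit sphere in the orthant of signs [s]. *)
Definition in_facet s v :=
  (forall i, 0 <= (-1) ^+ s i * v 0 i) /\ \sum_i (-1) ^+ s i * v 0 i = 1.

Lemma in_facet_l1 s v : in_facet s v -> \sum_i `|v 0 i| = 1.
Proof.
move=> [s0 <-]; apply: eq_bigr => i _.
by rewrite -(ger0_norm (s0 i)) normrM normr_sign mul1r.
Qed.

Lemma in_facet_convex s : barycenter_closed (in_facet s).
Proof.
move=> t t0 ts.
have m0 : 0 < (size t)%:R :> R by rewrite ltr0n; case: t t0 {ts}.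
have E i : (-1) ^+ s i * barycenter t 0 i =
    (size t)%:R^-1 * \sum_(v <- t) (-1) ^+ s i * v 0 i.
  by rewrite !mxE summxE mulrCA mulr_sumr.
split=> [i|].
  rewrite E mulr_ge0 ?invr_ge0 ?ler0n// big_seq sumr_ge0// => v /ts[] + _.
  exact.
under eq_bigr do rewrite E.
rewrite -mulr_sumr exchange_big big_seq (eq_bigr (fun=> 1)); last first.
  by move=> v /ts[].
by rewrite -big_seq sumr_const_seq mulVf ?gt_eqF.
Qed.

Lemma cross_in_facet k t : (k <= d.+1)%N -> t \in cross axis k ->
  exists s, forall v, v \in t -> in_facet s v.
Proof.
move=> kd /cross_vertices[s sP]; exists (fun i : 'I_d.+1 => s i) => v /sP[j jk ->].
have coord (i : 'I_d.+1) : (-1) ^+ s i * ((-1) ^+ s j *: axis j) 0 i = (i == inord j)%:R.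
  rewrite !mxE eqxx /=; case: eqP => [->|]; last by rewrite !mulr0.
  by rewrite inordK ?(leq_trans jk)// mulr1 -signr_addb addbb.
split=> [i|]; first by rewrite coord.
under eq_bigr do rewrite coord.
rewrite (bigD1 (inord j)) //= eqxx big1 ?addr0// => i /negbTE ->.
by [].
Qed.

Lemma iter_subdiv_in_facet N k t : (k <= d.+1)%N ->
  t \in iter N (@subdiv_chain R V k) (cross axis k) ->
  exists s, forall v, v \in t -> in_facet s v.
Proof.
move=> kd.
apply: (@iter_subdiv_ind _ _ k
  (fun t => exists s, forall v, v \in t -> in_facet s v)).
  by move=> u; exact: cross_in_facet.
move=> u u' [s sP] uu'; exists s.
exact: (subdiv_convex (in_facet_convex (s := s)) sP uu').
Qed.

Lemma iter_subdiv_mesh N t :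
  t \in iter N (@subdiv_chain R V d.+1) (hemisphere axis d) ->
  forall v w, v \in t -> w \in t -> `|v - w| <= 2 * (d%:R / d.+1%:R) ^+ N.
Proof.
elim: N t => [|N IH] t.
  move=> tH.
  have : t \in cross axis d.+1 by rewrite crossS mem_cat tH.
  case/cross_in_facet => // s sP.
  have v1 v : v \in t -> `|v| <= 1.
    move=> /sP/in_facet_l1 <-; apply: rV_norm_le => [|i]; first exact: sumr_ge0.
    by rewrite (bigD1 i)//= lerDl sumr_ge0.
  move=> v w vt wt; rewrite expr0 mulr1.
  by apply: le_trans (ler_normB _ _) _; rewrite -[2]/(1 + 1) lerD// v1.
move=> /flatten_mapP[u uN tu] v w vt wt; rewrite exprS mulrCA.
apply: (@subdiv_mesh _ _ d d.+1 u t) => //; last exact: IH.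
  apply: (@iter_subdiv_ind _ _ d.+1 (fun t => size t = d.+1)) uN => //.
    exact: size_hemisphere.
  by move=> ? ? _; exact: size_subdiv.
Qed.

(** Tucker's lemma on the l1 unit sphere, for arbitrarily fine triangulations. *)
Lemma antipodal_labels_vary (a : 'I_d -> V -> bool) N :
  (forall i v, v != 0 -> antipodal (a i) v) ->
  exists t, [/\ t != [::], forall v, v \in t -> \sum_i `|v 0 i| = 1,
    forall v w, v \in t -> w \in t -> `|v - w| <= 2 * (d%:R / d.+1%:R) ^+ N &
    forall i, exists p q, [/\ p \in t, q \in t & a i p != a i q]].
Proof.
move=> anti; pose ls := map a (enum 'I_d).
have szls : size ls = d by rewrite size_map size_enum_ord.
have l1_neq0 v : \sum_i `|v 0 i| = 1 -> v != 0.
  move=> v1; apply/eqP => v0; move: v1; rewrite v0 big1 => [/eqP|i _].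
    by rewrite eq_sym oner_eq0.
  by rewrite mxE normr0.
have mem_ls i : List.In (a i) ls.
  rewrite /ls; have : i \in enum 'I_d by rewrite mem_enum.
  by elim: (enum _) => //= j r IH; rewrite inE => /orP[/eqP->|/IH]; [left|right].
have ls_mem b : List.In b ls -> exists i, b = a i.
  by rewrite /ls; elim: (enum _) => //= j r IH [<-|/IH//]; exists j.
have := @cup_hemisphere R V axis N ls; rewrite szls.
case/(_ _)/xor_true => [b k t v /ls_mem[i ->] /leqW kd tk vt|t td cup_t].
  apply: anti; apply: l1_neq0.
  by have [s /(_ _ vt)/in_facet_l1] := iter_subdiv_in_facet kd tk.
have tsz : size t = d.+1.
  apply: (@iter_subdiv_ind _ _ d.+1 (fun t => size t = d.+1)) td => //.
    exact: size_hemisphere.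
  by move=> ? ? _; exact: size_subdiv.
exists t; split=> [|v vt||i].
- by case: t tsz {td cup_t}.
- have tE : t \in iter N (@subdiv_chain R V d.+1) (cross axis d.+1).
    by rewrite crossS iter_subdiv_cat mem_cat td.
  by have [s /(_ _ vt)/in_facet_l1] := iter_subdiv_in_facet (leqnn _) tE.
- exact: iter_subdiv_mesh.
- by apply: (cup_witness _ cup_t) => //; rewrite szls.
Qed.

(** The sign of a nonzero coordinate, the same one for [v] and [- v]: it makes
    the sign labels antipodal even where a function vanishes. *)
Definition vsign v : bool :=
  if [pick i | v 0 i != 0] is Some i then 0 < v 0 i else false.

Lemma vsign_opp v : v != 0 -> vsign (- v) = ~~ vsign v.
Proof.
move=> v0; rewrite /vsign (@eq_pick _ _ (fun i => v 0 i != 0)); last first.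
  by move=> i; rewrite mxE oppr_eq0.
case: pickP => [i vi|v00]; first by rewrite mxE oppr_gt0 lt_neqAle vi -leNgt.
by case/eqP: v0; apply/rowP => i; rewrite mxE; apply/eqP/negbFE; exact: v00.
Qed.

(** The simplices given by [antipodal_labels_vary] shrink towards a point [p] of
    the sphere.  If [g i] were nonzero at [p], its sign would be constant near
    [p], hence on one of these simplices. *)
Theorem borsuk_ulam (g : 'I_d -> V -> R) :
  (forall i v, v != 0 -> {for v, continuous (g i)}) ->
  (forall i v, v != 0 -> g i (- v) = - g i v) ->
  exists2 v, v != 0 & forall i, g i v = 0.
Proof.
move=> gc godd.
pose a i v := (0 < g i v) || (g i v == 0) && vsign v.
have anti i v : v != 0 -> antipodal (a i) v.
  move=> v0; rewrite /antipodal /a godd// vsign_opp// oppr_gt0 oppr_eq0.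
  by case: ltgtP; rewrite //= ?andbF.
have /choice[t tP] := fun N => antipodal_labels_vary N anti.
pose x N := head 0 (t N).
have xt N : x N \in t N.
  by have [+ _ _ _] := tP N; rewrite /x; case: (t N) => //= y s _; exact: mem_head.
have x1 N : \sum_i `|x N 0 i| = 1 by have [_ t1 _ _] := tP N; exact: t1.
have cK : compact [set v : V | forall i, `[-1, 1]%classic (v ord0 i : R)].
  by apply: (@rV_compact R _ (fun=> `[-1, 1]%classic)) => _; exact: segment_compact.
have xK : \forall N \near \oo, forall i, `[-1, 1]%classic (x N ord0 i : R).
  apply: nearW => N i; rewrite /= in_itv /= -ler_norml -(x1 N) (bigD1 i)//=.
  by rewrite lerDl sumr_ge0.
have [p [_ xp]] := cK (x @ \oo) _ xK.
have near_t e : 0 < e -> exists N,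
    forall v, v \in t N -> `|p - v| < e.
  move=> e0; have e20 : 0 < e / 2 by rewrite divr_gt0.
  have mesh : \forall N \near \oo, 2 * (d%:R / d.+1%:R) ^+ N < e / 2 :> R.
    have := @cvg_geometric R 2 (d%:R / d.+1%:R).
    rewrite ger0_norm ?divr_ge0// ltr_pdivrMr ?ltr0n// mul1r ltr_nat ltnSn.
    move=> /(_ isT)/cvgrPdist_lt/(_ _ e20); apply: filterS => N /=.
    by rewrite sub0r normrN; apply: le_lt_trans; exact: ler_norm.
  have mesh' : \forall N \near \oo, [set v | exists2 N, v = x N &
      2 * (d%:R / d.+1%:R) ^+ N < e / 2 :> R] (x N).
    by apply: filterS mesh => N ?; exists N.
  have [_ [[N -> Ne] pxN]] := xp _ _ mesh' (nbhsx_ballx p _ e20).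
  exists N => v vt; rewrite [e]splitr.
  have [_ _ /(_ _ _ (xt N) vt) xv _] := tP N.
  rewrite -(subrK (x N) p) -addrA.
  apply: le_lt_trans (ler_normD _ _) _; apply: ltrD.
    by move: pxN; rewrite -ball_normE.
  exact: le_lt_trans xv Ne.
(* a point of the l1 sphere has a coordinate of modulus at least [1 / (d + 1)] *)
have p_neq0 : p != 0.
  apply/eqP => p0.
  have [|N /(_ _ (xt N))] := near_t d.+1%:R^-1; first by rewrite invr_gt0.
  rewrite p0 sub0r normrN => xN; have := x1 N; apply/eqP; rewrite lt_eqF//.
  rewrite (@lt_le_trans _ _ (\sum_(i < d.+1) d.+1%:R^-1))//.
    apply: ltr_sum => [|i _]; first by apply/hasP; exists ord0; rewrite ?mem_index_enum.
    exact: le_lt_trans (rV_coord_le _ _) xN.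
  by rewrite sumr_const card_ord -(mulr_natl d.+1%:R^-1) divff// pnatr_eq0.
exists p => // i; apply/eqP; apply: contraT => gp.
have const_near (b : bool) : (\forall v \near p, a i v = b) -> false.
  move=> /nbhs_ballP[e /= e0 ab]; have [N tN] := near_t e e0.
  have tb v : v \in t N -> a i v = b.
    by move=> /tN pv; apply: ab; rewrite -ball_normE.
  have [_ _ _ /(_ i)[q [r [/tb -> /tb ->]]]] := tP N.
  by rewrite eqxx.
have [gp0|gp0|gp0] := ltgtP (g i p) 0; last by rewrite gp0 eqxx in gp.
- apply: (const_near false); apply: filterS (cvgr_lt _ (gc i p p_neq0) _ gp0) => v.
  by move=> gv; rewrite /a lt_eqF// ltNge ltW.
- apply: (const_near true); apply: filterS (cvgr_gt _ (gc i p p_neq0) _ gp0) => v.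
  by move=> gv; rewrite /a gv.
Qed.
End BorsukUlam.

(** * Functions vanishing at infinity and their maximum points *)

Section VanishingAtInfinity.
Variables (R : realType) (n : nat).
Local Notation V := 'rV[R]_n.
Implicit Types (f : C0 R n) (x y : V).

Lemma C0_continuous f : continuous (f : V -> R).
Proof. by have /asboolP[] := C0P f. Qed.

Lemma coord_le_enorm x i : `|x 0 i| <= enorm x.
Proof.
rewrite /enorm -sqrtr_sqr ler_wsqrtr// (bigD1 i)//= lerDl.
by apply: sumr_ge0 => j _; exact: sqr_ge0.
Qed.

Lemma C0_box f (eps : R) : 0 < eps ->
  exists r, forall x, eps <= `|f x| -> forall i, `[- r, r]%classic (x ord0 i).
Proof.
move=> eps0; have /asboolP[_ f0] := C0P f.
have small : \forall r \near +oo, [set x | r < enorm x] `<=`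
    [set x | `|f x : R| < eps].
  exact: (cvgr0Pnorm_lt (f : V -> R)).1 f0 eps eps0.
have [r rP] := filter_ex small.
exists r => x fx i; rewrite /= in_itv /= -ler_norml.
apply: le_trans (coord_le_enorm _ _) _; rewrite leNgt; apply/negP => rx.
by have := rP x rx; rewrite /= ltNge fx.
Qed.

(** Near-maximal values are taken only near the maximum point: the points at
    distance at least [e] where [f] is not small form a compact set [K], on
    which [f] attains a maximum less than [f x0]. *)
Lemma C0_well_posed f x0 (e : R) : 0 < f x0 ->
  (forall x, f x <= f x0) -> (forall y, (forall x, f x <= f y) -> y = x0) ->
  0 < e -> exists2 eta, 0 < eta & forall x, f x0 - eta < f x -> `|x0 - x| < e.
Proof.
move=> f0 maxf unif e0.
have f20 : 0 < f x0 / 2 by rewrite divr_gt0.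
have [r rP] := C0_box f f20.
pose K := [set x : V | forall i, `[- r, r]%classic (x ord0 i : R)]
            `&` ~` ball x0 e.
have cK : compact K.
  apply: compact_closedI; last by apply: open_closedC; exact: ball_open.
  by apply: (@rV_compact R _ (fun=> `[- r, r]%classic)) => _; exact: segment_compact.
have inK x : f x0 / 2 <= f x -> e <= `|x0 - x| -> K x.
  move=> fx xe; split; first by apply: rP; apply: le_trans (ler_norm _).
  by rewrite -ball_normE /= => /lt_geF; rewrite xe.
have [[k0 Kk0]|K0] := pselect (K !=set0); last first.
  exists (f x0 / 2) => // x fx; rewrite ltNge; apply/negP => /(inK _ _) Kx.
  by apply: K0; exists x; apply: Kx; rewrite ltW// (le_lt_trans _ fx)// {2}[f x0]splitr addrK.
have [k kK kmax] := @EVT_max_rV R n f K (ex_intro _ k0 Kk0) cK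
  (continuous_subspaceT (@C0_continuous f)).
have fk : f k < f x0.
  rewrite lt_neqAle maxf andbT; apply/eqP => fk.
  have kx0 : k = x0 by apply: unif => x; rewrite fk.
  by move: kK; rewrite inE => -[_]; rewrite kx0; apply; exact: ballxx.
exists (Num.min (f x0 / 2) (f x0 - f k)).
  by rewrite lt_min f20 subr_gt0.
move=> x; rewrite ltrBlDr -ltrBlDl lt_min => /andP[fx1 fx2].
rewrite ltNge; apply/negP => xe.
have /kmax : x \in K.
  by rewrite inE; apply: inK => //; lra.
by move=> fxk; lra.
Qed.

End VanishingAtInfinity.

Section LinearFamily.
Variables (R : realType) (n m : nat) (b : 'I_m -> C0 R n).
Local Notation V := 'rV[R]_n.
Implicit Types (c : 'rV[R]_m) (x y : V).

Definition comb c : C0 R n := \sum_i c 0 i *: b i.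

Lemma combE c x : comb c x = \sum_i c 0 i * b i x.
Proof.
rewrite /comb; transitivity ((\sum_i c 0 i *: (b i : V -> R^o)) x).
  congr (_ x); rewrite -[LHS]/(\val _) raddf_sum; apply: eq_bigr => i _.
  exact: linearZ.
by rewrite fct_sumE.
Qed.

Lemma combN c x : comb (- c) x = - comb c x.
Proof.
rewrite !combE -sumrN; apply: eq_bigr => i _; by rewrite mxE mulNr.
Qed.

Hypothesis unique_max : forall c, c != 0 ->
  exists! x0, forall x, comb c x <= comb c x0.

Definition argmax c : V := xget 0 [set x0 | forall x, comb c x <= comb c x0].

(** The positive part of the maximum; it is [0] for a nonpositive function, for
    which [argmax] may be discontinuous. *)
Definition pos_max c : R := Num.max (comb c (argmax c)) 0.

Lemma argmaxP c x : c != 0 -> comb c x <= comb c (argmax c).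
Proof.
move=> /unique_max[x0 [x0max _]].
by apply: (@xgetPex _ 0 [set x0 | forall x, comb c x <= comb c x0]); exists x0.
Qed.

Lemma argmax_unique c y :
  c != 0 -> (forall x, comb c x <= comb c y) -> y = argmax c.
Proof.
move=> c0 ymax; have [x0 [_ x0u]] := unique_max c0.
by rewrite -(x0u _ ymax); apply: x0u => x; exact: argmaxP.
Qed.

(** Each [b i] is bounded, since both [b i] and [- b i] have a maximum. *)
Lemma comb_lipschitz : exists2 B, 0 < B &
  forall c c' x, `|comb c x - comb c' x| <= B * `|c - c'|.
Proof.
have /choice[B BP] : forall i, exists B : R, forall x, `|b i x : R| <= B.
  move=> i; pose u : 'rV[R]_m := delta_mx 0 i.
  have u0 : u != 0.
    apply/eqP => /rowP/(_ i); rewrite !mxE !eqxx /= => /eqP.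
    by rewrite oner_eq0.
  have ub x : comb u x = b i x.
    rewrite combE (bigD1 i)//= big1 ?addr0 => [|j ji]; rewrite mxE eqxx ?eqxx ?mul1r//.
    by rewrite (negbTE ji) mul0r.
  exists (`|comb u (argmax u)| + `|comb (- u) (argmax (- u))|) => x.
  have := argmaxP x u0; have := argmaxP (c := - u) x.
  rewrite oppr_eq0 combN -ub => /(_ u0) bN bP.
  have := ler_norm (comb u (argmax u)).
  have := ler_norm (comb (- u) (argmax (- u))).
  have := normr_ge0 (comb u (argmax u)).
  have := normr_ge0 (comb (- u) (argmax (- u))).
  by rewrite ler_norml => *; lra.
exists (1 + \sum_i B i) => [|c c' x].
  rewrite ltr_pwDl// sumr_ge0// => i _; exact: le_trans (BP i 0).
rewrite !combE -sumrB; apply: le_trans (ler_norm_sum _ _ _) _.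
rewrite mulrDl mul1r mulr_suml ler_wpDl// ler_sum// => i _.
rewrite -mulrBl normrM mulrC ler_pM//.
by apply: le_trans (rV_coord_le _ i); rewrite !mxE.
Qed.

Lemma argmax_continuous c : c != 0 -> 0 < comb c (argmax c) ->
  {for c, continuous argmax}.
Proof.
move=> c0 M0; have [B B0 lip] := comb_lipschitz.
apply/(cvgrPdist_lt (F := nbhs c)) => e e0.
have [|y ymax|eta eta0 etaP] := C0_well_posed M0 _ _ e0.
- by move=> x; exact: argmaxP.
- exact: argmax_unique.
near=> c'; apply: etaP.
have c'0 : c' != 0 by near: c'; exact: (@cvgr_neq0 _ _ _ (nbhs c) _ id c cvg_id c0).
have small : B * `|c - c'| < eta / 2.
  rewrite -ltr_pdivlMl//; near: c'; apply: (@cvgr_dist_lt _ _ _ (nbhs c) _ id c cvg_id).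
  by rewrite mulr_gt0 ?invr_gt0 ?divr_gt0.
have := lip c c' (argmax c); have := lip c c' (argmax c').
have := argmaxP (argmax c) c'0.
by rewrite !ler_norml => ? /andP[? ?] /andP[? ?]; lra.
Unshelve. all: by end_near. Qed.

Lemma pos_max_continuous c : c != 0 -> {for c, continuous pos_max}.
Proof.
move=> c0; have [B B0 lip] := comb_lipschitz.
have half c1 c2 : c1 != 0 -> c2 != 0 -> pos_max c1 <= pos_max c2 + B * `|c1 - c2|.
  move=> c10 c20; have := argmaxP (argmax c1) c20.
  have := lip c1 c2 (argmax c1); rewrite ler_norml => /andP[_ H1] H2.
  have H3 : 0 <= B * `|c1 - c2| by rewrite mulr_ge0// ltW.
  rewrite {1}/pos_max ge_max addr_ge0 ?le_max ?lexx ?orbT// andbT.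
  have H4 : comb c2 (argmax c2) <= pos_max c2 by rewrite le_max lexx.
  by lra.
apply/(cvgrPdist_lt (F := nbhs c)) => e e0; near=> c'.
have c'0 : c' != 0 by near: c'; exact: (@cvgr_neq0 _ _ _ (nbhs c) _ id c cvg_id c0).
have small : B * `|c - c'| < e.
  rewrite -ltr_pdivlMl//; near: c'; apply: (@cvgr_dist_lt _ _ _ (nbhs c) _ id c cvg_id).
  by rewrite mulr_gt0 ?invr_gt0.
have := half _ _ c0 c'0; have := half _ _ c'0 c0; rewrite (distrC c').
by rewrite ltr_norml => *; apply/andP; split; lra.
Unshelve. all: by end_near. Qed.

(** Where [argmax] fails to be continuous, [pos_max] tends to [0] and [w] is
    bounded. *)
Lemma weighted_continuous (w : V -> R) (B : R) c : continuous w ->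
  (forall x, `|w x| <= B) -> c != 0 ->
  {for c, continuous (fun c => pos_max c * w (argmax c))}.
Proof.
move=> cw wB c0; have [Mpos|Mneg] := ltP 0 (comb c (argmax c)).
  apply: (@continuousM R _ pos_max (w \o argmax)); first exact: pos_max_continuous.
  by apply: continuous_comp; [exact: argmax_continuous|exact: cw].
have M0 : pos_max c = 0 by rewrite /pos_max max_r.
have Mc := pos_max_continuous c0.
rewrite /prop_for /continuous_at M0 in Mc.
rewrite /prop_for /continuous_at /= M0 mul0r.
apply/(cvgr0Pnorm_lt (F := nbhs c)) => e e0.
have B1 : 0 < 1 + `|B| by rewrite ltr_pwDl.
have eB : 0 < e / (1 + `|B|) by rewrite divr_gt0.
near=> c'.
have small : `|pos_max c'| < e / (1 + `|B|).
  by near: c'; exact: (cvgr0Pnorm_lt (F := nbhs c) pos_max).1 Mc _ eB.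
rewrite normrM; apply: le_lt_trans (_ : `|pos_max c'| * (1 + `|B|) < e).
  rewrite ler_wpM2l// (le_trans (wB _))// (le_trans (ler_norm _))// lerDr//.
by rewrite -ltr_pdivlMr.
Unshelve. all: by end_near. Qed.

End LinearFamily.

(** * No subspace of dimension n + 2 *)

Section TooManyFunctions.
Variables (R : realType) (n : nat) (b : 'I_n.+2 -> C0 R n).
Hypothesis n_gt0 : (0 < n)%N.
Hypothesis unique_max : forall c : 'rV_n.+2, c != 0 ->
  exists! x0, forall x, comb b c x <= comb b c x0.
Local Notation V := 'rV[R]_n.

(** The coordinates of an injective bounded map to [R^(n+1)].  The constant
    coordinate makes [pos_max c * chart x] determine [pos_max c]. *)
Definition chart (j : 'I_n.+1) (x : V) : R :=
  if unlift ord0 j is Some i then atan (x 0 i) else 1.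

Lemma chart_continuous j : continuous (chart j).
Proof.
rewrite /chart; case: (unlift _ _) => [i|] x; last exact: cst_continuous.
apply: (@continuous_comp _ _ _ (fun x : V => x 0 i) (@atan R)).
  exact: coord_continuous.
exact: continuous_atan.
Qed.

Lemma chart_bounded j x : `|chart j x| <= 1 + pi / 2.
Proof.
have pi0 := pi_ge0 R.
rewrite /chart; case: (unlift _ _) => [i|]; last by rewrite normr1; lra.
have := atan_ltpi2 (x 0 i); have := atan_gtNpi2 (x 0 i).
by rewrite ler_norml => *; apply/andP; split; lra.
Qed.

Definition chart_gap (j : 'I_n.+1) (c : 'rV[R]_n.+2) : R :=
  pos_max b c * chart j (argmax b c) -
  pos_max b (- c) * chart j (argmax b (- c)).

Lemma chart_gap_continuous j c : c != 0 -> {for c, continuous (chart_gap j)}.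
Proof.
move=> c0; have wc u : u != 0 -> {for u, continuous
    (fun c => pos_max b c * chart j (argmax b c))}.
  move=> u0; apply: (weighted_continuous unique_max _ _ u0).
    exact: chart_continuous.
  exact: chart_bounded.
pose h c := pos_max b c * chart j (argmax b c).
have Nwc : {for c, continuous (h \o -%R)}.
  apply: (@continuous_comp _ _ R (fun c : 'rV[R]_n.+2 => - c) h); first exact: opp_continuous.
  by apply: wc; rewrite oppr_eq0.
exact: (continuousB (wc _ c0) Nwc).
Qed.

Lemma chart_gap_nonzero c : c != 0 -> ~ forall j, chart_gap j c = 0.
Proof.
move=> c0 gap0; have Nc0 : - c != 0 by rewrite oppr_eq0.
have lec x := argmaxP unique_max x c0.
have geNc x := argmaxP unique_max x Nc0.
(* the constant coordinate of [chart] *)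
have max_eq : pos_max b c = pos_max b (- c).
  have := gap0 ord0; rewrite /chart_gap /chart unlift_none !mulr1.
  by move/eqP; rewrite subr_eq0 => /eqP.
have [y ycst] : exists y : R, forall x, comb b c x = y.
  have [M0|M0] := eqVneq (pos_max b c) 0.
    exists 0 => x; apply/le_anti/andP; split.
      by rewrite (le_trans (lec x))// -M0 le_max lexx.
    rewrite -oppr_le0 -combN (le_trans (geNc x))// -M0 max_eq.
    by rewrite le_max lexx.
  have arg_eq : argmax b c = argmax b (- c).
    apply/rowP => i; have := gap0 (lift ord0 i).
    rewrite /chart_gap /chart liftK -max_eq -mulrBr.
    move/eqP; rewrite mulf_eq0 (negbTE M0) subr_eq0 => /eqP.
    exact: (can_inj (@atanK R)).
  exists (comb b c (argmax b c)) => x; apply/le_anti/andP; split => //.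
  by rewrite -lerN2 -!combN arg_eq.
(* all points maximize a constant function, and [R^n] has at least two *)
have max_all z : z = argmax b c.
  by apply: argmax_unique => // x; rewrite !ycst.
have : const_mx 1 = 0 :> V by rewrite (max_all (const_mx 1)) (max_all 0).
move/rowP/(_ (Ordinal n_gt0))/eqP; rewrite !mxE.
by rewrite oner_eq0.
Qed.

Lemma too_many_functions : False.
Proof.
have [c c0 gap0] : exists2 c, c != 0 & forall j, chart_gap j c = 0.
  apply: borsuk_ulam => j c; first exact: chart_gap_continuous.
  by move=> _; rewrite /chart_gap opprK opprB.
exact: chart_gap_nonzero c0 gap0.
Qed.

End TooManyFunctions.

Lemma hatC0_not_lineable (R : realType) (n : nat) : (0 < n)%N ->
  ~ lineable (@hatC0 R n) n.+2.
Proof.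
move=> n0 [F [[b [indep span]] sub]].
apply: (@too_many_functions R n b n0) => c c0.
apply: sub; first by apply/span; exists (c 0).
by apply: contra c0 => /eqP/indep c0; apply/eqP/rowP => i; rewrite mxE c0.
Qed.

(** * A subspace of dimension n *)

Section Span.
Variables (K : fieldType) (E : lmodType K) (d : nat) (b : 'I_d -> E).

Definition span_pred : {pred E} :=
  fun v => `[< exists c : 'I_d -> K, v = \sum_i c i *: b i >].

Lemma span_submod_closed : submod_closed span_pred.
Proof.
split; first by apply/asboolP; exists (fun=> 0); rewrite big1// => i; rewrite scale0r.
move=> a u v /asboolP[c ->] /asboolP[c' ->]; apply/asboolP.
exists (fun i => a * c i + c' i); rewrite scaler_sumr -big_split /=.
by apply: eq_bigr => i _; rewrite scalerDl scalerA.
Qed.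

HB.instance Definition _ :=
  GRing.isSubmodClosed.Build K E span_pred span_submod_closed.

(** The condition on nonzero coefficients also contains the linear independence
    of [b]. *)
Lemma lineable_span (A : set E) :
  (forall c : 'I_d -> K, (exists i, c i != 0) ->
     \sum_i c i *: b i != 0 /\ A (\sum_i c i *: b i)) ->
  lineable A d.
Proof.
move=> bA; exists (span_pred : submodClosed E); split.
  exists b; split=> [c c0 i|v]; last by split=> [/asboolP|?]; [|apply/asboolP].
  apply/eqP; apply: contraT => ci.
  by have [|] := bA c; [exists i|rewrite c0 eqxx].
move=> v /asboolP[c ->] nz; apply: (bA c _).2.
apply: contrapT => c0; move/eqP: nz; apply; rewrite big1// => i _.
have [->|ci] := eqVneq (c i) 0; first exact: scale0r.
by case: c0; exists i.
Qed.

End Span.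

Section Bump.
Variables (R : realType) (n : nat).
Local Notation V := 'rV[R]_n.

Definition sqnorm (x : V) : R := \sum_i x 0 i ^+ 2.

Lemma sqnorm_ge0 x : 0 <= sqnorm x.
Proof. by apply: sumr_ge0 => i _; exact: sqr_ge0. Qed.

Lemma sqnorm_continuous : continuous sqnorm.
Proof.
have -> : sqnorm = \sum_i (fun x : V => x 0 i ^+ 2) by rewrite fct_sumE.
elim/big_ind: _ => [|f g cf cg|i _].
- exact: cst_continuous.
- by move=> x; exact: (@continuousD R R V f g x (cf x) (cg x)).
- move=> x; apply: (@continuousM R _ (fun x : V => x 0 i) (fun x : V => x 0 i));
  exact: coord_continuous.
Qed.

Definition bump_fun (i : 'I_n) (x : V) : R^o := x 0 i / (1 + sqnorm x).

Lemma bump_in_C0 i : bump_fun i \in @C0_pred R n.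
Proof.
have D0 x : 0 < 1 + sqnorm x by rewrite ltr_pwDl// sqnorm_ge0.
apply/asboolP; split.
  move=> x; apply: (@continuousM R _ (fun x : V => x 0 i)
    (fun x => (1 + sqnorm x)^-1)); first exact: coord_continuous.
  apply: (@continuousV R _ (fun x => 1 + sqnorm x)); first by rewrite gt_eqF.
  apply: (@continuousD R R V (fun=> 1) sqnorm); last exact: sqnorm_continuous.
  exact: cst_continuous.
apply/(cvgr0Pnorm_lt (F := @at_infinity R n)) => e e0.
rewrite /prop_near1 /nbhs /= /at_infinity /=.
near=> r => x /= rx.
have e1 : e^-1 < enorm x.
  by apply: lt_trans rx; near: r; apply: nbhs_pinfty_gt; exact: num_real.
have x2 : enorm x ^+ 2 = sqnorm x by rewrite sqr_sqrtr// sqnorm_ge0.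
rewrite /bump_fun normrM normfV (gtr0_norm (D0 x)) ltr_pdivrMr//.
apply: le_lt_trans (coord_le_enorm _ _) _.
have : 1 < e * enorm x by rewrite -ltr_pdivrMl// mulr1.
have : 0 < enorm x by apply: lt_trans e1; rewrite invr_gt0.
by rewrite -x2 => *; nra.
Unshelve. all: by end_near. Qed.

Definition bump i : C0 R n := MkC0 (bump_in_C0 i).

Lemma comb_bump (c : 'rV[R]_n) x :
  comb bump c x = (\sum_i c 0 i * x 0 i) / (1 + sqnorm x).
Proof. by rewrite combE mulr_suml; apply: eq_bigr => i _; rewrite mulrA. Qed.

(** Completing the square; for [N = |c|] the right-hand side is a positive
    multiple of [N / 2 - comb bump c x]. *)
Lemma bump_square (c x : V) (N : R) : N ^+ 2 = sqnorm c ->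
  \sum_i (N * x 0 i - c 0 i) ^+ 2 =
  N * (N * (1 + sqnorm x) - 2 * \sum_i c 0 i * x 0 i).
Proof.
move=> N2; rewrite mulrBr mulrA -expr2 mulrDr mulr1 {1}N2 /sqnorm !mulr_sumr.
rewrite -big_split -sumrB /=; apply: eq_bigr => i _; ring.
Qed.

Lemma bump_max (c : 'rV[R]_n) : c != 0 ->
  0 < enorm c /\ forall x, comb bump c x <= enorm c / 2 ?= iff
    (x == (enorm c)^-1 *: c).
Proof.
move=> c0; set N := enorm c.
have N2 : N ^+ 2 = sqnorm c by rewrite sqr_sqrtr// sqnorm_ge0.
have N0 : 0 < N.
  rewrite lt_neqAle sqrtr_ge0 andbT eq_sym; apply: contra c0 => /eqP NE.
  move: N2; rewrite NE expr0n /= => /esym/eqP.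
  rewrite psumr_eq0 => [/allP c0|i _]; last exact: sqr_ge0.
  apply/eqP/rowP => i; rewrite mxE; apply/eqP; rewrite -sqrf_eq0.
  by apply: c0; rewrite mem_index_enum.
split=> // x; have D0 : 0 < 1 + sqnorm x by rewrite ltr_pwDl// sqnorm_ge0.
have sq := bump_square x N2.
have gap : enorm c / 2 - comb bump c x =
    (\sum_i (N * x 0 i - c 0 i) ^+ 2) / (2 * N * (1 + sqnorm x)).
  rewrite comb_bump sq -/N; field.
  by rewrite !gt_eqF.
have den0 : 0 < 2 * N * (1 + sqnorm x) by rewrite !mulr_gt0.
split.
  rewrite -subr_ge0 gap divr_ge0 ?(ltW den0)//.
  by apply: sumr_ge0 => i _; exact: sqr_ge0.
rewrite eq_sym -subr_eq0 gap mulf_eq0 invr_eq0 (gt_eqF den0) orbF.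
rewrite psumr_eq0 => [|i _]; last exact: sqr_ge0.
apply/allP/eqP => [sq0|-> i _ /=]; last first.
  by rewrite sqrf_eq0 mxE mulVKf ?(gt_eqF N0)// subrr.
apply/rowP => i; rewrite mxE; apply: (mulfI (lt0r_neq0 N0)).
rewrite mulVKf ?(gt_eqF N0)//; apply/eqP.
by rewrite -subr_eq0 -sqrf_eq0; apply: sq0; rewrite mem_index_enum.
Qed.

Lemma hatC0_lineable : lineable (@hatC0 R n) n.
Proof.
apply: (@lineable_span _ _ _ bump) => c [i ci].
pose u : 'rV[R]_n := \row_i c i.
have -> : \sum_i c i *: bump i = comb bump u.
  by apply: eq_bigr => j _; rewrite mxE.
have u0 : u != 0 by apply: contra ci => /eqP/rowP/(_ i); rewrite !mxE => ->.
have [N0 maxu] := bump_max u0; pose x0 := (enorm u)^-1 *: u.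
have x0max : comb bump u x0 = enorm u / 2 by apply/eqP; rewrite (maxu x0).2.
split.
  apply/eqP => u00; move: x0max; rewrite u00 => /eqP.
  by rewrite eq_sym gt_eqF// divr_gt0.
exists x0; split=> [x|y ymax]; first by rewrite x0max (maxu x).1.
apply/esym/eqP; rewrite -(maxu y).2 eq_le (maxu y).1 /=.
by rewrite -x0max ymax.
Qed.

End Bump.

Theorem theorem7 (R : realType) (n : nat) (hn : (2 <= n)%N) :
  lineable (@hatC0 R n) n /\ ~ lineable (@hatC0 R n) (n + 2)%N.
Proof.
split; first exact: hatC0_lineable.
by rewrite addn2; apply: hatC0_not_lineable; exact: leq_trans hn.
Qed.
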